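(* There is a constant $c>0$ such that for every sequence of probabilities $p=p(n)\in[0,1]$ with $p(n)\geq\sqrt{c/n}$ for all sufficiently large $n$, the random $2$-complex $X^2(n,p)$ asymptotically almost surely has trivial fundamental group, i.e. $\Pr[\pi_1(X^2(n,p))=0]\to 1$ as $n\to\infty$.
   Context: A (finite abstract) simplicial complex is a finite set system closed under taking subsets; its members are called faces. The random $2$-complex $X^2(n,p)$ has vertex set $[n]=\{1,\dots,n\}$, contains all subsets of $[n]$ of cardinality at most $2$ (complete $1$-skeleton), and each $F\in\binom{[n]}{3}$ is a face independently with probability $p$. For a simplicial complex $X$, $\pi_1(X)$ denotes the fundamental group of the polyhedron $\|X\|$ of a geometric realization of $X$ (here $\|X\|$ is path-connected, so the basepoint is irrelevant). *)

(* Defs.v *)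
From HB Require Import structures.
From mathcomp Require Import all_boot all_order all_algebra.
From mathcomp Require Import all_classical all_reals all_analysis.
From mathcomp Require Import homotopy.

Set Implicit Arguments.
Unset Strict Implicit.
Unset Printing Implicit Defensive.

Import Order.TTheory GRing.Theory Num.Theory.
Import numFieldNormedType.Exports.

Local Open Scope classical_set_scope.
Local Open Scope ring_scope.

Section UnitInterval.
Variable R : realType.

Definition unit_interval : Type := set_type (`[0, 1]%classic : set R).

HB.instance Definition _ := Topological.copy unit_interval
  (set_type (`[0, 1]%classic : set R)).

Lemma unit_interval0_subproof : (0 : R) \in `[0, 1]%classic.
Proof. by rewrite inE /= in_itv /= lexx ler01. Qed.

Lemma unit_interval1_subproof : (1 : R) \in `[0, 1]%classic.
Proof. by rewrite inE /= in_itv /= lexx ler01. Qed.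

Definition unit_interval0 : unit_interval := SigSub unit_interval0_subproof.
Definition unit_interval1 : unit_interval := SigSub unit_interval1_subproof.

Lemma unit_interval01_subproof : unit_interval0 != unit_interval1.
Proof. by apply/eqP => /(congr1 (@set_val R _))/eqP; rewrite eq_sym oner_eq0. Qed.

HB.instance Definition _ :=
  isBiPointed.Build unit_interval unit_interval01_subproof.

End UnitInterval.

Section FundamentalGroup.
Variables (R : realType) (T : topologicalType).
Local Notation I := (unit_interval R).

Definition path_homotopic (x y : T) (f g : {path I from x to y}) : Prop :=
  exists H : I * I -> T,
    [/\ continuous H,
        forall s, H (s, zero) = f s /\ H (s, one) = g s
      & forall t, H (zero, t) = x /\ H (one, t) = y].

Definition homotopy_class (x y : T) (f : {path I from x to y}) :
    set {path I from x to y} :=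
  [set g | path_homotopic f g].

(* The underlying set of the fundamental group; its neutral element is the
   class of the constant loop. *)
Definition pi1 (x : T) : set (set {path I from x to x}) :=
  range (@homotopy_class x x).
Arguments pi1 x : clear implicits.

Definition pi1_trivial (x : T) : Prop :=
  pi1 x = [set homotopy_class (cst x : {path I from x to x})].

End FundamentalGroup.

Arguments pi1 R {T} x.
Arguments pi1_trivial R {T} x.

Section SimplicialComplexes.
Variable n : nat.

Definition subset_closed (K : {set {set 'I_n}}) : bool :=
  [forall F in K, forall G : {set 'I_n}, (G \subset F) ==> (G \in K)].

Record simplicial_complex := SimplicialComplex {
  faces : {set {set 'I_n}};
  facesP : subset_closed faces }.

Definition triples : {set {set 'I_n}} := [set F : {set 'I_n} | #|F| == 3]%SET.

Definition faces2 (T : {set {set 'I_n}}) : {set {set 'I_n}} :=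
  ([set F : {set 'I_n} | (#|F| <= 2)%N] :|: (T :&: triples))%SET.

Lemma faces2_subset_closed (T : {set {set 'I_n}}) : subset_closed (faces2 T).
Proof.
apply/forallP => F; apply/implyP => FT; apply/forallP => G; apply/implyP => GF.
have := FT; rewrite !inE => /orP[F2|/andP[TF /eqP F3]].
  by rewrite (leq_trans (subset_leq_card GF) F2).
have [->|GnF] := eqVneq G F; first by rewrite TF F3 eqxx orbT.
have GpF : G \proper F by rewrite finset.properEneq GnF GF.
by have := proper_card GpF; rewrite F3 ltnS => ->.
Qed.

(* The 2-complex with complete 1-skeleton whose 2-faces are the triples in T. *)
Definition complex2 (T : {set {set 'I_n}}) : simplicial_complex :=
  SimplicialComplex (faces2_subset_closed T).

Variable R : realType.

(* The standard geometric realization: vertex i goes to the i-th unit vector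
   of R^n. *)
Definition face_simplex (F : {set 'I_n}) : set 'rV[R]_n :=
  [set x | [/\ forall i, 0 <= x ord0 i, \sum_i x ord0 i = 1
             & forall i, i \notin F -> x ord0 i = 0]].

Definition polyhedron (X : simplicial_complex) : set 'rV[R]_n :=
  \bigcup_(F in [set` faces X]) face_simplex F.

(* The polyhedron carries the subspace topology. All base points are
   considered: when the polyhedron is path-connected they are equivalent. *)
Definition complex_pi1_trivial (X : simplicial_complex) : Prop :=
  forall x : set_type (polyhedron X), pi1_trivial R x.

(* Law of X^2(n, p): the set T of 2-faces is a random subset of the triples,
   each one included independently with probability p. *)
Definition triples_weight (p : R) (T : {set {set 'I_n}}) : R :=
  \prod_(F in triples) (if F \in T then p else 1 - p).

Definition Pr_X2 (p : R) (E : set simplicial_complex) : R :=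
  \sum_(T in powerset triples | `[< E (complex2 T) >]) triples_weight p T.

End SimplicialComplexes.

(* Main.v *)
(** Call a triple of vertices null if its triangle is null-homotopic in the
    polyhedron.  Faces are null, and a, b, c is null as soon as abx, bcx and acx
    are (cone over x).  Fix a <> b and join x to y when axy and bxy are both
    faces: the set of c with abc null is then a union of components of this
    graph, which is a G(n, p^2) on the vertices other than a and b.  As
    p^2 >= 32 / n, with probability 1 - O(n^-3) no union of components has
    between n/3 and 2n/3 vertices, so there is a minimal one, the core, with
    more than 2n/3 vertices.  The core is independent of the faces containing
    a and b, and p n >> log n, so some abx with x in the core is a face; hence
    abc is null for more than 2n/3 of the vertices c.  When this holds for every
    pair, the sets of x for which abx, bcx and acx are null have a common
    element, so every triple is null.  By simplicial approximation every path is
    then homotopic to a polyline that depends only on its endpoints. *)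

Require Import Defs.
From mathcomp Require Import all_boot all_order all_algebra.
From mathcomp Require Import all_classical all_reals all_analysis.
From mathcomp Require Import homotopy.
From mathcomp Require Import lra ring zify.

Import Order.TTheory GRing.Theory Num.Theory.
Import numFieldNormedType.Exports.

Local Open Scope classical_set_scope.
Local Open Scope ring_scope.

Set Implicit Arguments.
Unset Strict Implicit.
Unset Printing Implicit Defensive.

(** * Homotopies of paths in a subset of a normed module *)

Section Clamp.
Variable R : realType.

Definition clamp (t : R) : R := Num.max 0 (Num.min 1 t).

Variant clamp_spec (t : R) : R -> Prop :=
  | ClampLt of t <= 0 : clamp_spec t 0
  | ClampIn of 0 <= t & t <= 1 : clamp_spec t t
  | ClampGt of 1 <= t : clamp_spec t 1.

Lemma clampP (t : R) : clamp_spec t (clamp t).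
Proof.
rewrite /clamp; case: (leP 1 t) => t1.
  by rewrite max_r ?ler01 //; constructor.
by case: (leP 0 t) => t0; constructor => //; exact: ltW.
Qed.

Lemma clamp01 (t : R) : 0 <= clamp t <= 1.
Proof. by case: clampP => *; apply/andP; split; lra. Qed.

Lemma clamp_id (t : R) : 0 <= t -> t <= 1 -> clamp t = t.
Proof. by case: clampP => *; lra. Qed.

Lemma clamp_le0 (t : R) : t <= 0 -> clamp t = 0.
Proof. by case: clampP => *; lra. Qed.

Lemma clamp_ge1 (t : R) : 1 <= t -> clamp t = 1.
Proof. by case: clampP => *; lra. Qed.

Lemma clampK (t : R) : clamp (clamp t) = clamp t.
Proof. by have /andP[] := clamp01 t; exact: clamp_id. Qed.

Lemma clamp_ends : (clamp (2 * 0) = 0) * (clamp (2 * 1) = 1) *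
  (clamp (2 * 0 - 1) = 0) * (clamp (2 * 1 - 1) = 1).
Proof. by do !split; case: clampP => *; lra. Qed.

Section Continuity.
Variable S : topologicalType.

Lemma contD (U : normedModType R) (f g : S -> U) :
  continuous f -> continuous g -> continuous (fun s => f s + g s).
Proof. by move=> cf cg s; apply: continuousD; [exact: cf|exact: cg]. Qed.

Lemma contN (U : normedModType R) (f : S -> U) :
  continuous f -> continuous (fun s => - f s).
Proof. by move=> cf s; apply: continuousN; exact: cf. Qed.

Lemma contZ (U : normedModType R) (k : S -> R) (f : S -> U) :
  continuous k -> continuous f -> continuous (fun s => k s *: f s).
Proof. by move=> ck cf s; apply: continuousZ; [exact: ck|exact: cf]. Qed.

Lemma contM (k l : S -> R) :
  continuous k -> continuous l -> continuous (fun s => k s * l s).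
Proof. by move=> ck cf s; apply: continuousM; [exact: ck|exact: cf]. Qed.

Lemma cont_comp (U W : topologicalType) (f : S -> U) (g : U -> W) :
  continuous g -> continuous f -> continuous (fun s => g (f s)).
Proof. by move=> cg cf s; apply: continuous_comp; [exact: cf|exact: cg]. Qed.

Lemma cont_pair (U W : topologicalType) (f : S -> U) (g : S -> W) :
  continuous f -> continuous g -> continuous (fun s => (f s, g s)).
Proof. by move=> cf cg s; apply: cvg_pair; [exact: cf|exact: cg]. Qed.

End Continuity.

Lemma cont_id (S : topologicalType) : continuous (fun s : S => s).
Proof. by move=> s. Qed.

Lemma cont_cst (S U : topologicalType) (u : U) : continuous (fun _ : S => u).
Proof. by move=> s; exact: cvg_cst. Qed.

Lemma cont_fst (S U : topologicalType) : continuous (fun z : S * U => z.1).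
Proof. by move=> z; exact: cvg_fst. Qed.

Lemma cont_snd (S U : topologicalType) : continuous (fun z : S * U => z.2).
Proof. by move=> z; exact: cvg_snd. Qed.

Lemma cont_clamp : continuous clamp.
Proof.
move=> t; apply: (@continuous_max R R^o (cst 0) (fun t => Num.min 1 t)).
  exact: cvg_cst.
by apply: (@continuous_min R R^o (cst 1) id); [exact: cvg_cst|exact: cvg_id].
Qed.

End Clamp.

Ltac cont := repeat match goal with
  | H : continuous ?f |- continuous ?f => exact: H
  | |- continuous (fun s => @?f s + @?g s) => apply: contD
  | |- continuous (fun s => - @?f s) => apply: contN
  | |- continuous (fun s => @?f s *: @?g s) => apply: contZ
  | |- continuous (fun s => @?f s * @?g s) => apply: contM
  | |- continuous (fun s => fst s) => exact: cont_fst
  | |- continuous (fun s => snd s) => exact: cont_snd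
  | |- continuous (fun s => s) => exact: cont_id
  | |- continuous (fun s => ?c) => exact: cont_cst
  | |- continuous ( *%R ?c) => exact: mulrl_continuous
  | |- continuous fst => exact: cont_fst
  | |- continuous snd => exact: cont_snd
  | |- continuous (@clamp _) => exact: cont_clamp
  | |- continuous (fun s => (@?f s, @?g s)) => apply: cont_pair
  | H : continuous ?f |- continuous (fun s => ?f (@?g s)) =>
      apply: (cont_comp (f := g) H)
  | |- continuous (fun s => clamp (@?g s)) =>
      apply: (cont_comp (f := g) (@cont_clamp _))
  end.

Section PathsInSubset.
Variables (R : realType) (V : normedModType R) (P : set V).
Implicit Types (f g h : R -> V) (x y : V).

(* Paths are functions on the whole of R; only their restriction to [0, 1] matters. *)
Definition path_in f := continuous f /\ forall s, P (f s).

Definition homotopic f g := exists H : R * R -> V,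
  [/\ continuous H, forall z, P (H z),
      forall s, H (s, 0) = f s /\ H (s, 1) = g s
    & forall t, H (0, t) = f 0 /\ H (1, t) = f 1].

(* Adding the two halves and subtracting the common value makes continuity
   immediate: no pasting lemma is needed. *)
Definition cat f g : R -> V :=
  fun s => f (clamp (2 * s)) + (g (clamp (2 * s - 1)) - f 1).

Definition seg x y : R -> V := fun s => x + clamp s *: (y - x).

Lemma seg0 x y : seg x y 0 = x.
Proof. by rewrite /seg clamp_le0 // scale0r addr0. Qed.

Lemma seg1 x y : seg x y 1 = y.
Proof. by rewrite /seg clamp_ge1 // scale1r addrC subrK. Qed.

Lemma seg_cont x y : continuous (seg x y).
Proof. rewrite /seg; cont. Qed.

Lemma cat_cont f g : continuous f -> continuous g -> continuous (cat f g).
Proof. move=> cf cg; rewrite /cat; cont. Qed.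

Lemma catE f g s : f 1 = g 0 ->
  cat f g s = if s <= 2^-1 then f (clamp (2 * s)) else g (clamp (2 * s - 1)).
Proof.
move=> fg; rewrite /cat; case: ifPn => [s2|]; last rewrite -ltNge => s2.
  by rewrite (@clamp_le0 _ (2 * s - 1)) ?fg ?subrr ?addr0 //; lra.
by rewrite (@clamp_ge1 _ (2 * s)) 1?addrC ?subrK //; lra.
Qed.

Lemma cat0 f g : f 1 = g 0 -> cat f g 0 = f 0.
Proof.
by move=> fg; rewrite catE // ifT ?invr_ge0 ?ler0n // mulr0 clamp_le0.
Qed.

Lemma cat1 f g : f 1 = g 0 -> cat f g 1 = g 1.
Proof. by move=> fg; rewrite catE // ifF ?clamp_ge1 //; lra. Qed.

Lemma path_in_cat f g : path_in f -> path_in g -> f 1 = g 0 -> path_in (cat f g).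
Proof.
move=> [cf Pf] [cg Pg] fg; split; first exact: cat_cont.
by move=> s; rewrite catE //; case: ifP.
Qed.

Lemma path_in_comp f (phi : R -> R) :
  path_in f -> continuous phi -> path_in (fun s => f (phi s)).
Proof. by move=> [cf Pf] cphi; split => //; cont. Qed.

Lemma hom_sym f g : homotopic f g -> homotopic g f.
Proof.
move=> [H [cH PH H01 Hs]]; exists (fun z => H (z.1, 1 - z.2)); split.
- by cont.
- by move=> z; exact: PH.
- by move=> s /=; rewrite subr0 subrr; case: (H01 s).
- move=> t /=; case: (Hs (1 - t)) => -> ->.
  by case: (H01 0) (H01 1) (Hs 1) => _ <- [_ <-] [].
Qed.

Lemma hom_trans f g h : homotopic f g -> homotopic g h -> homotopic f h.
Proof.
move=> [H [cH PH H01 Hs]] [G [cG PG G01 Gs]].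
(* The device of [cat], now in the second variable: in each half of the time one of the two terms
   equals the middle path [g] and cancels. *)
exists (fun z => H (z.1, clamp (2 * z.2)) + (G (z.1, clamp (2 * z.2 - 1)) - g z.1)).
have cg : continuous g.
  by rewrite (_ : g = fun s => G (s, 0)); [cont|apply/funext => s; case: (G01 s)].
have gE s : H (s, 1) = g s /\ G (s, 0) = g s.
  by case: (H01 s) => _ ->; case: (G01 s).
have e0 : f 0 = g 0 by case: (gE 0) => <- _; case: (Hs 1).
have e1 : f 1 = g 1 by case: (gE 1) => <- _; case: (Hs 1).
split.
- by cont.
- move=> [s t] /=; case: (leP t 2^-1) => t2.
    rewrite (@clamp_le0 _ (2 * t - 1)); last by lra.
    by case: (gE s) => _ ->; rewrite subrr addr0.
  rewrite (@clamp_ge1 _ (2 * t)); last by lra.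
  by case: (gE s) => -> _; rewrite addrC subrK.
- move=> s /=; rewrite !clamp_ends; case: (gE s) => -> ->.
  case: (G01 s) (H01 s) => _ -> [-> _].
  by rewrite subrr addr0 [g s + _]addrC subrK.
- move=> t /=; case: (Hs (clamp (2 * t))) => -> ->.
  by case: (Gs (clamp (2 * t - 1))) => -> ->; rewrite !subrr !addr0.
Qed.

(** The parameter moves linearly from [phi s] to [psi s]. Intermediate parameters need no bounds,
    since [f] stays in [P] on the whole line. *)
Lemma hom_reparam f (phi psi : R -> R) :
  path_in f -> continuous phi -> continuous psi ->
  phi 0 = psi 0 -> phi 1 = psi 1 ->
  homotopic (fun s => f (phi s)) (fun s => f (psi s)).
Proof.
move=> [cf Pf] cphi cpsi e0 e1.
exists (fun z => f (phi z.1 + z.2 * (psi z.1 - phi z.1))); split => //=.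
- by cont.
- by move=> s; rewrite mul0r addr0 mul1r addrC subrK.
- by move=> t; rewrite e0 e1 !subrr !mulr0 !addr0.
Qed.

Lemma hom_refl f : path_in f -> homotopic f f.
Proof. by move=> pf; apply: (@hom_reparam f id id) => //; exact: cont_id. Qed.

Lemma hom_ends f g : homotopic f g -> f 0 = g 0 /\ f 1 = g 1.
Proof.
move=> [H [cH PH H01 Hs]].
by case: (Hs 1) => <- <-; case: (H01 0) (H01 1) => _ -> [_ ->].
Qed.

Lemma hom_line f g : path_in f -> path_in g -> f 0 = g 0 -> f 1 = g 1 ->
  (forall s t, 0 <= t -> t <= 1 -> P (f s + t *: (g s - f s))) -> homotopic f g.
Proof.
move=> [cf _] [cg _] e0 e1 fgP.
exists (fun z => f z.1 + clamp z.2 *: (g z.1 - f z.1)); split => /=.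
- by cont.
- by move=> z; have /andP[] := clamp01 z.2; exact: fgP.
- by move=> s; rewrite clamp_le0 // clamp_ge1 // scale0r addr0 scale1r addrC subrK.
- by move=> t; rewrite e0 e1 !subrr !scaler0 !addr0.
Qed.

Lemma hom_cat f f' g g' : homotopic f f' -> homotopic g g' -> f 1 = g 0 ->
  homotopic (cat f g) (cat f' g').
Proof.
move=> hf hg fg; have [f0 f1] := hom_ends hf; have [g0 g1] := hom_ends hg.
move: hf hg => [H [cH PH H01 Hs]] [G [cG PG G01 Gs]].
exists (fun z => H (clamp (2 * z.1), z.2) + (G (clamp (2 * z.1 - 1), z.2) - f 1)).
split => /=.
- by cont.
- move=> [s t] /=; case: (leP s 2^-1) => s2.
    rewrite (@clamp_le0 _ (2 * s - 1)); last by lra.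
    by case: (Gs t) => -> _; rewrite fg subrr addr0.
  rewrite (@clamp_ge1 _ (2 * s)); last by lra.
  by case: (Hs t) => _ ->; rewrite addrC subrK.
- move=> s; rewrite /cat -f1.
  by case: (H01 (clamp (2 * s))) (G01 (clamp (2 * s - 1))) => -> -> [-> ->].
- move=> t; rewrite cat0 // cat1 // !clamp_ends.
  case: (Hs t) (Gs t) => -> -> [-> ->].
  by rewrite fg subrr addr0 addrC subrK.
Qed.

(** Both bracketings run along one path [F], which follows [f], [g], [h] on [0, 1], [1, 2], [2, 3];
    they differ only in speed. *)
Lemma cat_assoc f g h : path_in f -> path_in g -> path_in h ->
  f 1 = g 0 -> g 1 = h 0 ->
  homotopic (cat (cat f g) h) (cat f (cat g h)).
Proof.
move=> [cf Pf] [cg Pg] [ch Ph] fg gh.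
pose F s := f (clamp s) + (g (clamp (s - 1)) - f 1) + (h (clamp (s - 2)) - g 1).
have PF : path_in F.
  split; first by rewrite /F; cont.
  move=> s; rewrite /F; case: (leP s 1) => s1.
    rewrite (@clamp_le0 _ (s - 1)) ?(@clamp_le0 _ (s - 2)); [|lra|lra].
    by rewrite fg gh !subrr !addr0.
  rewrite (@clamp_ge1 _ s) 1?ltW // [f 1 + _]addrC subrK.
  case: (leP s 2) => s2; first by rewrite (@clamp_le0 _ (s - 2)) ?gh ?subrr ?addr0 //; lra.
  by rewrite (@clamp_ge1 _ (s - 1)) 1?addrC ?subrK //; lra.
(* The first half of the time covers [0, 2] under [phi], but only [0, 1] under [psi]. *)
pose phi (s : R) := 2 * clamp (2 * s) + clamp (2 * s - 1).
pose psi (s : R) := clamp (2 * s) + 2 * clamp (2 * s - 1).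
have -> : cat (cat f g) h = fun s => F (phi s).
  apply/funext => s; rewrite {1}/cat cat1 // {1}/cat /F /phi.
  have := clamp01 (2 * s); have := clamp01 (2 * s - 1).
  case: (leP s 2^-1) => s2.
    rewrite (@clamp_le0 _ (2 * s - 1)); last by lra.
    move: (clamp _) => u _ /andP[u0 u1].
    by rewrite addr0 (@clamp_le0 _ (2 * u - 2)) //; lra.
  rewrite (@clamp_ge1 _ (2 * s)); last by lra.
  have := clampK (2 * s - 1); move: (clamp (2 * s - 1)) => v vK /andP[v0 v1] _.
  have -> : 2 * 1 + v - 2 = v by lra.
  by rewrite vK !clamp_ge1 //; lra.
have -> : cat f (cat g h) = fun s => F (psi s).
  apply/funext => s; rewrite /cat /F /psi.
  have [-> -> ->] : [/\ clamp (clamp (2 * s) + 2 * clamp (2 * s - 1)) = clamp (2 * s),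
    clamp (clamp (2 * s) + 2 * clamp (2 * s - 1) - 1) = clamp (2 * clamp (2 * s - 1))
    & clamp (clamp (2 * s) + 2 * clamp (2 * s - 1) - 2) = clamp (2 * clamp (2 * s - 1) - 1)].
    have := clamp01 (2 * s); have := clamp01 (2 * s - 1).
    case: (leP s 2^-1) => s2.
      rewrite (@clamp_le0 _ (2 * s - 1)); last by lra.
      have := clampK (2 * s); move: (clamp (2 * s)) => u uK _ /andP[u0 u1].
      by rewrite mulr0 addr0 uK !(clamp_le0 (t := _ - _)) ?(clamp_le0 (t := 0)) //; lra.
    rewrite (@clamp_ge1 _ (2 * s)); last by lra.
    move: (clamp (2 * s - 1)) => v /andP[v0 v1] _; split.
    - by rewrite !clamp_ge1 //; lra.
    - by congr clamp; lra.
    - by congr clamp; lra.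
  by rewrite -!addrA; congr (_ + (_ + _)); rewrite [RHS]addrC -!addrA.
apply: hom_reparam => //; rewrite /phi /psi; cont; rewrite ?mulr0 ?mulr1; do ?case: clampP => *; lra.
Qed.

Lemma segment_flip x y (t : R) : x + t *: (y - x) = y + (1 - t) *: (x - y).
Proof. by rewrite scalerBl scale1r addrA [y + (x - y)]addrC subrK -scalerN opprB. Qed.

Lemma path_in_seg x y :
  (forall t, 0 <= t -> t <= 1 -> P (x + t *: (y - x))) -> path_in (seg x y).
Proof.
move=> xy; split; first exact: seg_cont.
by move=> s; have /andP[] := clamp01 s; exact: xy.
Qed.

(** Serves for paths in the star of a vertex [v]. A linear homotopy to the detour could leave [P],
    because only segments ending at [v] are controlled; hence the change of timing below. *)
Lemma hom_through f v : path_in f ->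
  (forall s t, 0 <= t -> t <= 1 -> P (f s + t *: (v - f s))) ->
  homotopic f (cat (seg (f 0) v) (seg v (f 1))).
Proof.
move=> pf fv.
have pseg0 : path_in (seg (f 0) v) by apply: path_in_seg => t; exact: fv.
have pseg1 : path_in (seg v (f 1)).
  by apply: path_in_seg => t t0 t1; rewrite segment_flip; apply: fv; lra.
set g := cat _ _; have pg : path_in g by apply: path_in_cat; rewrite ?seg0 ?seg1.
(* Wait at [f 0], follow [f], wait at [f 1]; meanwhile go to [v], wait, return:
   at each time the two points lie on a common segment ending at [v]. *)
pose phi (s : R) := clamp (3 * s - 1).
pose psi (s : R) := 2^-1 * (clamp (3 * s) + clamp (3 * s - 2)).
have cphi : continuous phi by rewrite /phi; cont.
have cpsi : continuous psi by rewrite /psi; cont.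
have phi0 : phi 0 = 0 by rewrite /phi clamp_le0 //; lra.
have phi1 : phi 1 = 1 by rewrite /phi clamp_ge1 //; lra.
have psi0 : psi 0 = 0 by rewrite /psi !clamp_le0; lra.
have psi1 : psi 1 = 1 by rewrite /psi !clamp_ge1; lra.
have hphi : homotopic f (fun s => f (phi s)).
  by apply: (@hom_reparam f id) => //; exact: cont_id.
have hpsi : homotopic (fun s => g (psi s)) g.
  by apply: (@hom_reparam g psi id) => //; exact: cont_id.
apply: hom_trans hphi _; apply: hom_trans hpsi; apply: hom_line.
- exact: path_in_comp.
- exact: path_in_comp.
- by rewrite phi0 psi0 /g cat0 ?seg0 ?seg1.
- by rewrite phi1 psi1 /g cat1 ?seg0 ?seg1.
move=> s t t0 t1; case: (leP (3 * s) 1) => s1.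
  have -> : psi s = 2^-1 * clamp (3 * s).
    by rewrite /psi (@clamp_le0 _ (3 * s - 2)) ?addr0 //; lra.
  rewrite /phi (@clamp_le0 _ (3 * s - 1)); last by lra.
  have /andP[] := clamp01 (3 * s); move: (clamp _) => u u0 u1.
  rewrite /g catE ?seg0 ?seg1 // ifT; last by lra.
  rewrite /seg mulrA mulfV ?mul1r ?clampK; last by lra.
  rewrite clamp_id // [X in _ *: X]addrAC subrr add0r scalerA.
  by apply: fv; nra.
rewrite {1}/psi (@clamp_ge1 _ (3 * s)) 1?ltW //.
case: (leP (3 * s) 2) => s2.
  rewrite (@clamp_le0 _ (3 * s - 2)); last by lra.
  rewrite /g catE ?seg0 ?seg1 // ifT; last by lra.
  rewrite (_ : 2 * _ = 1); last by lra.
  by rewrite (clamp_ge1 (lexx _)) seg1; exact: fv.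
rewrite /phi (@clamp_ge1 _ (3 * s - 1)); last by lra.
have /andP[] := clamp01 (3 * s - 2); move: (clamp (3 * s - 2)) => u u0 u1.
have -> : g (2^-1 * (1 + u)) = f 1 + (1 - u) *: (v - f 1).
  rewrite /g /cat clamp_ge1; last by lra.
  rewrite addrC subrK (_ : 2 * _ - 1 = u); last by lra.
  by rewrite clamp_id // /seg clamp_id // segment_flip.
by rewrite [X in _ *: X]addrAC subrr add0r scalerA; apply: fv; nra.
Qed.

Lemma hom_convex (C : set V) f g :
  (forall x y t, C x -> C y -> 0 <= t -> t <= 1 -> C (x + t *: (y - x))) ->
  C `<=` P -> continuous f -> continuous g ->
  (forall s, C (f s)) -> (forall s, C (g s)) ->
  f 0 = g 0 -> f 1 = g 1 -> homotopic f g.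
Proof.
move=> Cc CP cf cg Cf Cg e0 e1; apply: hom_line => //.
- by split => // s; exact: CP.
- by split => // s; exact: CP.
- by move=> s t t0 t1; apply: CP; exact: Cc.
Qed.

Lemma cat_cst_l f : path_in f -> homotopic (cat (seg (f 0) (f 0)) f) f.
Proof.
move=> pf; have -> : cat (seg (f 0) (f 0)) f = fun s => f (clamp (2 * s - 1)).
  by apply/funext => s; rewrite /cat seg1 /seg subrr scaler0 addr0 addrC subrK.
apply: (@hom_reparam f _ id) => //; rewrite ?clamp_ends //; [by cont|exact: cont_id].
Qed.

Lemma cat_cst_r f : path_in f -> homotopic (cat f (seg (f 1) (f 1))) f.
Proof.
move=> pf; have -> : cat f (seg (f 1) (f 1)) = fun s => f (clamp (2 * s)).
  by apply/funext => s; rewrite /cat /seg subrr scaler0 addr0 subrr addr0.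
apply: (@hom_reparam f _ id) => //; rewrite ?clamp_ends //; [by cont|exact: cont_id].
Qed.

(** The empty list gives the constant path, so every polyline ends with a constant piece;
    [polyline_seg1] removes it where it matters. *)
Fixpoint polyline x (l : seq V) : R -> V :=
  if l is y :: l' then cat (seg x y) (polyline y l') else seg x x.

Fixpoint segs_in x (l : seq V) : Prop :=
  if l is y :: l' then path_in (seg x y) /\ segs_in y l' else P x.

Lemma polyline0 x l : polyline x l 0 = x.
Proof. by elim: l x => [|y l IH] x /=; rewrite ?cat0 ?seg0 // IH seg1. Qed.

Lemma polyline1 x l : polyline x l 1 = last x l.
Proof. by elim: l x => [|y l IH] x /=; rewrite ?cat1 ?seg1 ?polyline0. Qed.

Lemma polyline_cont x l : continuous (polyline x l).
Proof.
elim: l x => [|y l IH] x; first exact: seg_cont.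
by apply: cat_cont; [exact: seg_cont|exact: IH].
Qed.

Lemma path_in_polyline x l : segs_in x l -> path_in (polyline x l).
Proof.
elim: l x => [|y l IH] x /= => [Px|[xy yl]].
  by apply: path_in_seg => t _ _; rewrite subrr scaler0 addr0.
by apply: path_in_cat; rewrite ?seg1 ?polyline0 //; exact: IH.
Qed.

Lemma hom_polyline_cons x y l l' : path_in (seg x y) ->
  homotopic (polyline y l) (polyline y l') ->
  homotopic (polyline x (y :: l)) (polyline x (y :: l')).
Proof.
move=> xy ll' /=; apply: hom_cat => //; first exact: hom_refl.
by rewrite seg1 polyline0.
Qed.

Lemma polyline_cat x l l' : segs_in x l -> segs_in (last x l) l' ->
  homotopic (cat (polyline x l) (polyline (last x l) l')) (polyline x (l ++ l')).
Proof.
elim: l x => [|y l IH] x /= => [_ vl'|[xy vl] vl'].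
  by rewrite -{1 2}(polyline0 x l'); apply: cat_cst_l; exact: path_in_polyline.
apply: hom_trans (cat_assoc _ _ _ _ _) _.
- by [].
- exact: path_in_polyline.
- exact: path_in_polyline.
- by rewrite seg1 polyline0.
- by rewrite polyline1 polyline0.
- apply: hom_cat; rewrite ?seg1 ?cat0 ?polyline1 ?polyline0 //.
  + exact: hom_refl.
  + exact: IH.
Qed.

(** Null-homotopy of the triangle x y z, expressed with paths that have common ends instead of a
    closed boundary loop. *)
Definition flat x y z := homotopic (cat (seg x y) (seg y z)) (seg x z).

(** The elementary move on edge paths: a corner is cut across a null triangle. Read backwards, it
    inserts a corner. *)
Lemma polyline_flat x l y z l' :
  segs_in x (l ++ [:: y, z & l']) -> flat (last x l) y z ->
  homotopic (polyline x (l ++ [:: y, z & l'])) (polyline x (l ++ z :: l')).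
Proof.
elim: l x => [|w l IH] x /= => [[xy [yz zl']]|[xw wl]] fl; last first.
  by apply: hom_polyline_cons => //; exact: IH.
have pl' := path_in_polyline zl'.
apply: hom_trans (hom_sym (cat_assoc _ _ _ _ _)) _; rewrite ?seg1 ?seg0 ?polyline0 //.
by apply: hom_cat; rewrite ?cat1 ?seg0 ?seg1 ?polyline0 //; exact: hom_refl.
Qed.

Lemma polyline_seg1 x y : path_in (seg x y) ->
  homotopic (polyline x [:: y]) (seg x y).
Proof. by move=> /cat_cst_r; rewrite seg1. Qed.

Lemma flatP x y z : path_in (seg x y) -> path_in (seg y z) ->
  homotopic (polyline x [:: y; z]) (polyline x [:: z]) -> path_in (seg x z) ->
  flat x y z.
Proof.
move=> xy yz h xz; apply: hom_trans (hom_trans h (polyline_seg1 xz)).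
apply: hom_cat; last by rewrite seg0 seg1.
  exact: hom_refl.
exact/hom_sym/polyline_seg1.
Qed.

End PathsInSubset.

(** * Paths in the polyhedron *)

Section PolyhedronPaths.
Variables (R : realType) (n : nat) (X : simplicial_complex n).
Local Notation P := (@polyhedron n R X).
Local Notation hom := (homotopic P).
Implicit Types (f g : R -> 'rV[R]_n) (i j k u v w : 'I_n) (F : {set 'I_n}).

Definition vertex i : 'rV[R]_n := delta_mx ord0 i.

Lemma face_simplex_convex F (x y : 'rV[R]_n) (t : R) :
  face_simplex F x -> face_simplex F y -> 0 <= t -> t <= 1 ->
  face_simplex F (x + t *: (y - x)).
Proof.
move=> [x0 x1 xF] [y0 y1 yF] t0 t1; split.
- by move=> i; rewrite !mxE; have := x0 i; have := y0 i; nra.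
- under eq_bigr do rewrite !mxE.
  by rewrite big_split /= -mulr_sumr sumrB x1 y1 subrr mulr0 addr0.
- by move=> i iF; rewrite !mxE xF // yF // subrr mulr0 addr0.
Qed.

Lemma face_simplex_vertex F i : i \in F -> face_simplex F (vertex i).
Proof.
move=> iF; split.
- by move=> j; rewrite mxE eqxx /= ler0n.
- rewrite (bigD1 i) //= mxE !eqxx big1 ?addr0 // => j ji.
  by rewrite mxE (negbTE ji) andbF.
- move=> j jF; rewrite mxE eqxx /=; case: eqP => // ji.
  by rewrite ji iF in jF.
Qed.

Lemma face_simplex_sub F : F \in faces X -> face_simplex F `<=` P.
Proof. by move=> FX x xF; exists F. Qed.

Lemma face_simplex_mem F (x : 'rV[R]_n) i : face_simplex F x -> 0 < x ord0 i -> i \in F.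
Proof. by move=> [_ _ xF]; apply: contraTT => /xF ->; rewrite ltxx. Qed.

Lemma hom_simplex F f g : F \in faces X -> continuous f -> continuous g ->
  (forall s, face_simplex F (f s)) -> (forall s, face_simplex F (g s)) ->
  f 0 = g 0 -> f 1 = g 1 -> hom f g.
Proof.
move=> FX; apply: hom_convex; first by move=> x y t; exact: face_simplex_convex.
exact: face_simplex_sub.
Qed.

Lemma face_simplex_seg F (x y : 'rV[R]_n) s :
  face_simplex F x -> face_simplex F y -> face_simplex F (seg x y s).
Proof. by move=> xF yF; have /andP[] := clamp01 s; exact: face_simplex_convex. Qed.

Lemma face_simplex_cat F f g s : f 1 = g 0 ->
  (forall s, face_simplex F (f s)) -> (forall s, face_simplex F (g s)) ->
  face_simplex F (cat f g s).
Proof. by move=> fg fF gF; rewrite catE //; case: ifP. Qed.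

Lemma flat_simplex F (x y z : 'rV[R]_n) : F \in faces X ->
  face_simplex F x -> face_simplex F y -> face_simplex F z ->
  flat P x y z.
Proof.
move=> FX Fx Fy Fz; have e : seg x y 1 = seg y z 0 by rewrite seg0 seg1.
apply: (hom_simplex FX).
- by apply: cat_cont; exact: seg_cont.
- exact: seg_cont.
- by move=> s; apply: face_simplex_cat => // t; exact: face_simplex_seg.
- by move=> s; exact: face_simplex_seg.
- by rewrite cat0 // !seg0.
- by rewrite cat1 // !seg1.
Qed.

Lemma path_in_seg_simplex F (x y : 'rV[R]_n) : F \in faces X ->
  face_simplex F x -> face_simplex F y -> path_in P (seg x y).
Proof.
move=> FX Fx Fy; split; first exact: seg_cont.
by move=> s; apply: (face_simplex_sub FX); exact: face_simplex_seg.
Qed.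

Lemma flat_face i j k : [set i; j; k]%SET \in faces X ->
  flat P (vertex i) (vertex j) (vertex k).
Proof.
move=> FX; apply: (flat_simplex FX); apply: face_simplex_vertex;
by rewrite !inE eqxx ?orbT.
Qed.

Hypothesis edgesX : forall i j, [set i; j]%SET \in faces X.

Lemma path_in_edge i j : path_in P (seg (vertex i) (vertex j)).
Proof.
by apply: (path_in_seg_simplex (edgesX i j)); apply: face_simplex_vertex;
   rewrite !inE eqxx ?orbT.
Qed.

Lemma vertex_in i : P (vertex i).
Proof. by case: (path_in_edge i i) => _ /(_ 0); rewrite seg0. Qed.

Lemma flat_edge i j k : k \in [set i; j]%SET ->
  [/\ flat P (vertex i) (vertex j) (vertex k), flat P (vertex i) (vertex k) (vertex j)
   & flat P (vertex k) (vertex i) (vertex j)].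
Proof.
move=> kij; have vij u : u \in [set i; j]%SET -> face_simplex [set i; j]%SET (vertex u).
  exact: face_simplex_vertex.
by split; apply: (flat_simplex (edgesX i j)); apply: vij => //; rewrite !inE eqxx ?orbT.
Qed.

Local Notation Q i j k := (flat P (vertex i) (vertex j) (vertex k)).

Lemma flat_swap23 i j k : Q i j k -> Q i k j.
Proof.
move=> q; apply: flatP; [exact: path_in_edge|exact: path_in_edge| |exact: path_in_edge].
apply: (hom_trans (g := polyline (vertex i) [:: vertex j; vertex k; vertex j])).
  apply: hom_sym; apply: (polyline_flat (l := [::])) => //=.
  by do ?[split; first exact: path_in_edge]; exact: vertex_in.
apply: (hom_trans (g := polyline (vertex i) [:: vertex j; vertex j])).
  apply: (polyline_flat (l := [:: vertex j])) => /=.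
    by do ?[split; first exact: path_in_edge]; exact: vertex_in.
  by case: (@flat_edge j k j); rewrite // !inE eqxx.
apply: (polyline_flat (l := [::])) => /=.
  by do ?[split; first exact: path_in_edge]; exact: vertex_in.
by case: (@flat_edge i j j); rewrite // !inE eqxx ?orbT.
Qed.

(** Moves, listing the vertices passed: i j k, i v j k, i v j v k, i v v k, i v k, i k. The first,
    second and last use the three hypotheses, the others degenerate triangles. *)
Lemma flat_cone i j k v : Q i j v -> Q j k v -> Q i k v -> Q i j k.
Proof.
move=> ij jk ik; apply: flatP; [exact: path_in_edge|exact: path_in_edge| |exact: path_in_edge].
apply: (hom_trans (g := polyline (vertex i) [:: vertex v; vertex j; vertex k])).
  apply: hom_sym; apply: (polyline_flat (l := [::])) => /=.
    by do ?[split; first exact: path_in_edge]; exact: vertex_in.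
  exact: flat_swap23.
apply: (hom_trans (g := polyline (vertex i) [:: vertex v; vertex j; vertex v; vertex k])).
  apply: hom_sym; apply: (polyline_flat (l := [:: vertex v; vertex j])) => /=.
    by do ?[split; first exact: path_in_edge]; exact: vertex_in.
  exact: flat_swap23.
apply: (hom_trans (g := polyline (vertex i) [:: vertex v; vertex v; vertex k])).
  apply: (polyline_flat (l := [:: vertex v])) => /=.
    by do ?[split; first exact: path_in_edge]; exact: vertex_in.
  by case: (@flat_edge v j v); rewrite // !inE eqxx ?orbT.
apply: (hom_trans (g := polyline (vertex i) [:: vertex v; vertex k])).
  apply: (polyline_flat (l := [:: vertex v])) => /=.
    by do ?[split; first exact: path_in_edge]; exact: vertex_in.
  by case: (@flat_edge v k v); rewrite // !inE eqxx ?orbT.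
apply: (polyline_flat (l := [::])) => /=.
  by do ?[split; first exact: path_in_edge]; exact: vertex_in.
exact: flat_swap23.
Qed.

(** * Simplicial approximation of paths in the polyhedron *)

Hypothesis flatX : forall i j k, Q i j k.

Lemma polyhedron_carrier (x : 'rV[R]_n) : P x ->
  exists2 F, F \in faces X & face_simplex F x /\ forall v, 0 < x ord0 v -> v \in F.
Proof.
by move=> [F FX xF]; exists F => //; split => // v; exact: face_simplex_mem.
Qed.

Lemma star_segment (x : 'rV[R]_n) v : P x -> 0 < x ord0 v ->
  forall t, 0 <= t -> t <= 1 -> P (x + t *: (vertex v - x)).
Proof.
move=> /polyhedron_carrier[F FX [Fx Fv]] xv t t0 t1; apply: (face_simplex_sub FX).
by apply: face_simplex_convex => //; apply: face_simplex_vertex; exact: Fv.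
Qed.

Lemma star_exists (x : 'rV[R]_n) : P x -> exists v, 0 < x ord0 v.
Proof.
move=> [F _ [x0 x1 _]]; apply: contrapT => /forallNP xle.
have : \sum_i x ord0 i = 0.
  apply: big1 => i _; apply/eqP; rewrite eq_le x0 andbT leNgt.
  exact/negP/xle.
by rewrite x1 => /eqP; rewrite oner_eq0.
Qed.

(** A Lebesgue number for the cover of [0, 1] by the preimages of the open vertex stars, drawn from
    compactness in its near-covering form. *)
Lemma star_subdivision f : path_in P f -> exists N : nat,
  forall t : R, 0 <= t <= 1 -> exists v,
    forall r, `|r - t| <= N.+1%:R^-1 -> 0 < f r ord0 v.
Proof.
move=> [cf Pf].
pose S (N : nat) (t : R) := exists v,
  forall r, `|r - t| <= N.+1%:R^-1 -> 0 < f r ord0 v.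
have : compact `[(0 : R), 1]%classic by exact: segment_compact.
move/compact_near_coveringP => /(_ nat \oo S _).
case => [x _|N _ SN]; last first.
- exists N => t t01; apply: (SN N) => //=.
- have [v xv] := star_exists (Pf x).
  have : \forall r \near x, 0 < f r ord0 v.
    have cv : {for x, continuous (fun r => f r ord0 v)}.
      apply: (@continuous_comp _ _ _ f (fun M : 'rV[R]_n => M ord0 v)).
        exact: cf.
      exact: coord_continuous.
    exact: (cvgr_gt _ cv).
  move=> /nbhs_ballP[e /= e0 xe].
  (* Half of [e] is spent on the distance from x to t, the other half on that from t to r. *)
  exists (ball x (e / 2), [set N : nat | N.+1%:R^-1 < e / 2]).
    split => /=; first by apply: nbhsx_ballx; rewrite divr_gt0.
    have e20 : 0 < e / 2 by rewrite divr_gt0.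
    exact: (near_infty_natSinv_lt (PosNum e20)).
  move=> [t N] /= [xt Ne]; exists v => r rt; apply: xe.
  rewrite -ball_normE /= in xt *.
  rewrite (splitr e) (_ : x - r = (x - t) + (t - r)); last by rewrite addrA subrK.
  rewrite (le_lt_trans (ler_normD _ _)) // ltrD // distrC (le_lt_trans rt) //.
Qed.

Lemma path_in_star (x : 'rV[R]_n) v : P x -> 0 < x ord0 v ->
  path_in P (seg x (vertex v)) /\ path_in P (seg (vertex v) x).
Proof.
move=> Px xv; split; apply: path_in_seg => t t0 t1; first exact: star_segment.
by rewrite segment_flip; apply: star_segment => //; lra.
Qed.

Lemma hom_star f v : path_in P f -> (forall s, 0 < f s ord0 v) ->
  hom f (polyline (f 0) [:: vertex v; f 1]).
Proof.
move=> pf fv; have Pf s : P (f s) by case: pf.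
apply: (hom_trans (g := cat (seg (f 0) (vertex v)) (seg (vertex v) (f 1)))).
  by apply: hom_through => // s; exact: star_segment.
have [p0 _] := path_in_star (Pf 0) (fv 0).
have [_ p1] := path_in_star (Pf 1) (fv 1).
rewrite /=; apply: hom_cat; rewrite ?seg1 ?seg0 //; first exact: hom_refl.
exact/hom_sym/polyline_seg1.
Qed.

(** The start of the induction in [hom_canonical]: x, u and w lie in one face, and a face is
    convex. *)
Lemma hom_carrier (x : 'rV[R]_n) u w : P x -> 0 < x ord0 u -> 0 < x ord0 w ->
  hom (fun=> x) (polyline x [:: vertex u; vertex w; x]).
Proof.
move=> /polyhedron_carrier[F FX [Fx Fv]] /Fv Fu /Fv Fw.
have Fl (l : seq 'rV[R]_n) : {in l, forall y, face_simplex F y} -> forall y s,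
    face_simplex F y -> face_simplex F (polyline y l s).
  elim: l => [|z l IH] lF y s Fy /=; first exact: face_simplex_seg.
  have Fz : face_simplex F z by apply: lF; rewrite inE eqxx.
  apply: face_simplex_cat; rewrite ?seg1 ?polyline0 // => t.
    exact: face_simplex_seg.
  by apply: IH => // z' z'l; apply: lF; rewrite inE z'l orbT.
have Fp s : face_simplex F (polyline x [:: vertex u; vertex w; x] s).
  apply: Fl => // y; rewrite !inE => /or3P[]/eqP-> //; exact: face_simplex_vertex.
apply: (hom_simplex FX) => //.
- exact: cont_cst.
- exact: polyline_cont.
- by rewrite polyline0.
- by rewrite polyline1.
Qed.

(** The induction step of [hom_canonical]. Moves: x u v y v z, x u v v z, x u v z, x u v w z, x u w
    z. The first three take place in a carrier of y or of z; the last one cuts across the triangle u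
    v w, null by [flatX]. *)
Lemma hom_extend (x y z : 'rV[R]_n) u v w : P x -> P y -> P z ->
  0 < x ord0 u -> 0 < y ord0 v -> 0 < z ord0 v -> 0 < z ord0 w ->
  hom (polyline x [:: vertex u; vertex v; y; vertex v; z])
      (polyline x [:: vertex u; vertex w; z]).
Proof.
move=> Px Py Pz xu yv zv zw.
have [xu1 xu2] := path_in_star Px xu.
have [yv1 yv2] := path_in_star Py yv.
have [zv1 zv2] := path_in_star Pz zv.
have [zw1 zw2] := path_in_star Pz zw.
have uv i j := path_in_edge i j.
have [Fy FyX [FyF Fyv]] := polyhedron_carrier Py.
have [Fz FzX [FzF Fzv]] := polyhedron_carrier Pz.
have fv : face_simplex Fy (vertex v) by apply: face_simplex_vertex; exact: Fyv.
have zfv : face_simplex Fz (vertex v) by apply: face_simplex_vertex; exact: Fzv.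
have zfw : face_simplex Fz (vertex w) by apply: face_simplex_vertex; exact: Fzv.
apply: (hom_trans (g := polyline x [:: vertex u; vertex v; vertex v; z])).
  apply: (polyline_flat (l := [:: vertex u; vertex v])) => //=.
  exact: (flat_simplex FyX).
apply: (hom_trans (g := polyline x [:: vertex u; vertex v; z])).
  apply: (polyline_flat (l := [:: vertex u; vertex v])) => //=.
  exact: (flat_simplex FzX).
apply: (hom_trans (g := polyline x [:: vertex u; vertex v; vertex w; z])).
  apply: hom_sym; apply: (polyline_flat (l := [:: vertex u; vertex v])) => //=.
  exact: (flat_simplex FzX).
by apply: (polyline_flat (l := [:: vertex u])) => //=.
Qed.

(** Simplicial approximation, one piece of a fine subdivision at a time: over each piece the path
    stays in a single open star, and the polyline reached so far is shortened at once to two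
    intermediate vertices. *)
Lemma hom_canonical f u w : path_in P f -> 0 < f 0 ord0 u -> 0 < f 1 ord0 w ->
  hom f (polyline (f 0) [:: vertex u; vertex w; f 1]).
Proof.
move=> pf fu; have [cf Pf] := pf; have [N fN] := star_subdivision pf.
have N0 : 0 < N.+1%:R^-1 :> R by rewrite invr_gt0 ltr0n.
(* The vertex [v] is left free because the induction hypothesis is used at the vertex whose star
   contains the next piece of the path, not at the vertex wanted at the end. *)
suff H (k : nat) v : (k <= N.+1)%N -> 0 < f (k%:R / N.+1%:R) ord0 v ->
    hom (fun s => f (k%:R / N.+1%:R * clamp s))
        (polyline (f 0) [:: vertex u; vertex v; f (k%:R / N.+1%:R)]).
  move=> fw; have := H N.+1 w (leqnn _); rewrite divff ?pnatr_eq0 // => /(_ fw).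
  apply: hom_trans; apply: (@hom_reparam _ _ _ f id) => //.
  - exact: cont_id.
  - by cont.
  - by rewrite clamp_le0 // mulr0.
  - by rewrite clamp_ge1 // mulr1.
elim: k v => [|k IH] v kN fv.
  rewrite mul0r in fv *; under eq_fun do rewrite mul0r.
  exact: hom_carrier.
set a := k%:R / N.+1%:R in IH *.
have a0 : 0 <= a by rewrite divr_ge0 ?ler0n.
have a1 : a <= 1 by rewrite ler_pdivrMr ?ltr0n // mul1r ler_nat ltnW.
have aS : k.+1%:R / N.+1%:R = a + N.+1%:R^-1 by rewrite -natr1 mulrDl mul1r.
rewrite aS in fv *; set b := N.+1%:R^-1 in N0 fv *.
have [|i fi] := fN a; first by rewrite a0.
have fai : 0 < f a ord0 i by apply: fi; rewrite subrr normr0 ltW.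
have fabi : 0 < f (a + b) ord0 i.
  by apply: fi; rewrite addrAC subrr add0r ger0_norm // ltW.
pose g1 s := f (a * clamp s); pose g2 s := f (a + b * clamp s).
have cg1 : continuous (fun s => a * clamp s).
  by cont.
have cg2 : continuous (fun s => a + b * clamp s).
  by cont.
have g10 : g1 0 = f 0 by rewrite /g1 clamp_le0 // mulr0.
have g11 : g1 1 = f a by rewrite /g1 clamp_ge1 // mulr1.
have g20 : g2 0 = f a by rewrite /g2 clamp_le0 // mulr0 addr0.
have g21 : g2 1 = f (a + b) by rewrite /g2 clamp_ge1 // mulr1.
have h1 : hom g1 (polyline (f 0) [:: vertex u; vertex i; f a]).
  by apply: IH => //; exact: ltnW.
have h2 : hom g2 (polyline (f a) [:: vertex i; f (a + b)]).
  rewrite -g20 -g21; apply: hom_star; first exact: path_in_comp.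
  move=> s; apply: fi; rewrite addrAC subrr add0r.
  by have /andP[c0 c1] := clamp01 s; rewrite ger0_norm -/b ?ler_piMr ?mulr_ge0 ?(ltW N0).
pose phi (s : R) := a * clamp (2 * s) + b * clamp (2 * s - 1).
apply: (hom_trans (g := fun s => f (phi s))).
  apply: (@hom_reparam _ _ _ f) => //.
  - by cont.
  - by rewrite /phi; cont.
  - by rewrite /phi !clamp_ends (clamp_le0 (lexx _)) !mulr0 addr0.
  - by rewrite /phi !clamp_ends (clamp_ge1 (lexx _)) !mulr1.
have -> : (fun s => f (phi s)) = cat g1 g2.
  apply/funext => s; rewrite catE ?g11 ?g20 // /phi /g1 /g2 !clampK.
  case: ifPn => [s2|]; last rewrite -ltNge => s2.
    by rewrite (@clamp_le0 _ (2 * s - 1)) ?mulr0 ?addr0 //; lra.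
  by rewrite (@clamp_ge1 _ (2 * s)) ?mulr1 //; lra.
apply: hom_trans (hom_cat h1 h2 _) _; first by rewrite g11 g20.
have [fu1 fu2] := path_in_star (Pf 0) fu.
have [ai1 ai2] := path_in_star (Pf a) fai.
have [abi1 abi2] := path_in_star (Pf (a + b)) fabi.
have uv j k := path_in_edge j k.
apply: hom_trans (polyline_cat _ _) _ => //=.
exact: hom_extend.
Qed.

Lemma polyhedron_simply_connected f g : path_in P f -> path_in P g ->
  f 0 = g 0 -> f 1 = g 1 -> hom f g.
Proof.
move=> pf pg fg0 fg1.
have [u fu] : exists u, 0 < f 0 ord0 u by case: pf => _ Pf; exact: star_exists.
have [w fw] : exists w, 0 < f 1 ord0 w by case: pf => _ Pf; exact: star_exists.
apply: hom_trans (hom_canonical pf fu fw) (hom_sym _).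
by rewrite fg0 fg1; apply: hom_canonical; rewrite -?fg0 -?fg1.
Qed.

End PolyhedronPaths.

(** * From paths on the real line to the fundamental group *)

Section FundamentalGroupTransfer.
Variables (R : realType) (V : normedModType R) (P : set V).
Local Notation I := (unit_interval R).

Lemma continuous_set_type (S T : topologicalType) (A : set T) (f : S -> set_type A) :
  continuous (fun s => set_val (f s)) -> continuous f.
Proof. exact: continuous_comp_initial. Qed.

Lemma clamp_in_unit (t : R) : clamp t \in `[0, 1]%classic.
Proof. by rewrite inE /= in_itv /=; exact: clamp01. Qed.

Definition to_unit (t : R) : I := SigSub (clamp_in_unit t).

Lemma to_unit_continuous : continuous to_unit.
Proof. by apply: continuous_set_type; exact: cont_clamp. Qed.

Lemma to_unit_val (s : I) : to_unit (set_val s) = s.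
Proof.
apply: val_inj => /=; have := set_valP s; rewrite /= in_itv /= => /andP[].
exact: clamp_id.
Qed.

Lemma pi1_trivial_homotopic (x : set_type P) :
  (forall f g : R -> V, path_in P f -> path_in P g ->
    f 0 = g 0 -> f 1 = g 1 -> homotopic P f g) ->
  pi1_trivial R x.
Proof.
(* When all loops are homotopic, every homotopy class is the full set of loops, so there is only one
   class. *)
move=> sc; suff H (f g : {path I from x to x}) : path_homotopic f g.
  have classE (f : {path I from x to x}) : homotopy_class f = setT.
    by apply/seteqP; split => // g _; exact: H.
  apply/seteqP; split => [_ [f _ <-]|_ ->] /=; first by rewrite !classE.
  by exists (cst x : {path I from x to x}).
(* A loop on the unit interval is extended to the line by the retraction [to_unit], constantly
   outside [0, 1]. *)
pose lift (h : {path I from x to x}) t := set_val (h (to_unit t)).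
have path_lift h : path_in P (lift h).
  split; last by move=> s; exact: set_valP.
  move=> s; apply: (@continuous_comp _ _ _ (fun s => h (to_unit s)) set_val).
    apply: continuous_comp; first exact: to_unit_continuous.
    exact: cts_fun.
  exact: initial_continuous.
have to0 : to_unit 0 = zero by apply: val_inj; rewrite /= clamp_le0.
have to1 : to_unit 1 = one by apply: val_inj; rewrite /= clamp_ge1.
have lift0 h : lift h 0 = set_val x by rewrite /lift to0 path_zero.
have lift1 h : lift h 1 = set_val x by rewrite /lift to1 path_one.
have [||H [cH PH H01 Hs]] := sc _ _ (path_lift f) (path_lift g).
- by rewrite !lift0.
- by rewrite !lift1.
exists (fun z => SigSub (mem_set (PH (set_val z.1, set_val z.2)))); split.
- have cval : continuous (@set_val R `[0, 1]%classic : I -> R).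
    exact: initial_continuous.
  apply: continuous_set_type; apply: (cont_comp cH).
  apply: (@cont_pair _ _ _ (fun z : I * I => set_val z.1) (fun z => set_val z.2)).
    exact: (cont_comp cval (@cont_fst _ _)).
  exact: (cont_comp cval (@cont_snd _ _)).
- move=> s; have [h0 h1] := H01 (set_val s); split; apply: val_inj => /=.
    by rewrite h0 /lift to_unit_val.
  by rewrite h1 /lift to_unit_val.
- move=> t; have [h0 h1] := Hs (set_val t); split; apply: val_inj => /=.
    by rewrite h0 lift0.
  by rewrite h1 lift1.
Qed.

End FundamentalGroupTransfer.

Lemma complex_pi1_trivial_flat (R : realType) (n : nat) (X : simplicial_complex n) :
  (forall i j, [set i; j]%SET \in faces X) ->
  (forall i j k, flat (@polyhedron n R X) (vertex R i) (vertex R j) (vertex R k)) ->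
  complex_pi1_trivial R X.
Proof.
by move=> e t x; apply: pi1_trivial_homotopic; exact: polyhedron_simply_connected.
Qed.

(** * Null triangles and cuts of the common link *)

(** Each complement has fewer than n/3 points, so the three complements cannot cover everything. *)
Lemma meet_three_large (n : nat) (A B C : {set 'I_n}) :
  (2 * n < 3 * #|A| -> 2 * n < 3 * #|B| -> 2 * n < 3 * #|C| ->
  exists v, [&& v \in A, v \in B & v \in C])%N.
Proof.
have le_n (D : {set 'I_n}) : (#|D| <= n)%N by rewrite -[leqRHS]card_ord max_card.
have := le_n (A :|: B)%SET; have := le_n (A :&: B :|: C)%SET.
have := cardsUI A B; have := cardsUI (A :&: B)%SET C.
move=> e1 e2 l1 l2 a b c.
have /set0Pn[v] : (A :&: B :&: C)%SET != finset.set0.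
  rewrite -card_gt0; move: e1 e2 l1 l2 a b c.
  move: #|(A :&: B :&: C)%SET| #|(A :|: B)%SET| #|(A :&: B :|: C)%SET| #|(A :&: B)%SET|.
  move: #|A| #|B| #|C| => a b c i u v w.
  lia.
by rewrite !inE -andbA; exists v.
Qed.

Section CutSets.
Variables (T : finType) (e : rel T).
Implicit Types W G : {set T}.

(** No edge joins [W] to its complement: [W] is a union of components of the graph. *)
Definition separated W := [forall x, forall y, e x y ==> ((x \in W) == (y \in W))].

Lemma separatedP W :
  reflect (forall x y, e x y -> (x \in W) = (y \in W)) (separated W).
Proof.
apply: (iffP forallP) => [sW x y exy|sW x].
  by have /forallP/(_ y)/implyP/(_ exy)/eqP := sW x.
by apply/forallP => y; apply/implyP => exy; apply/eqP/sW.
Qed.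

Lemma separatedI W G : separated W -> separated G -> separated (W :&: G)%SET.
Proof.
by move=> /separatedP sW /separatedP sG; apply/separatedP => x y exy;
  rewrite !inE (sW _ _ exy) (sG _ _ exy).
Qed.

Lemma separatedD W G : separated W -> separated G -> separated (W :\: G)%SET.
Proof.
by move=> /separatedP sW /separatedP sG; apply/separatedP => x y exy;
  rewrite !inE (sW _ _ exy) (sG _ _ exy).
Qed.

Lemma separatedT : separated [set: T]%SET.
Proof. by apply/separatedP => x y _; rewrite !inE. Qed.

(* A smallest union of components with more than two thirds of the points. *)
Definition core : {set T} :=
  [arg min_(W < [set: T]%SET | separated W && (2 * #|T| < 3 * #|W|)) #|W|]%N.

Definition no_balanced_cut :=
  [forall W, separated W ==> ~~ ((#|T| <= 3 * #|W|) && (3 * #|W| <= 2 * #|T|))]%N.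

Lemma core_spec : (0 < #|T|)%N ->
  [/\ separated core, (2 * #|T| < 3 * #|core|)%N
    & forall W, separated W -> (2 * #|T| < 3 * #|W|)%N -> (#|core| <= #|W|)%N].
Proof.
move=> T0; rewrite /core; case: arg_minnP => [|W /andP[sW W2] Wmin].
  by rewrite separatedT cardsT; lia.
by split => // G sG G2; apply: Wmin; rewrite sG.
Qed.

(** The core cannot be split. If its part in [G] has more than two thirds of the points, minimality
    makes that part the whole core. Otherwise that part has less than a third, so the part outside
    [G] has more than a third and, with no balanced cut, more than two thirds; minimality then
    contradicts the presence of x in [G]. *)
Lemma core_sub G x : no_balanced_cut -> separated G -> x \in core -> x \in G ->
  core \subset G.
Proof.
move=> /forallP nb sG xK xG; have T0 : (0 < #|T|)%N by apply/card_gt0P; exists x.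
have [sK K2 Kmin] := core_spec T0.
have sI := separatedI sK sG; have sD := separatedD sK sG.
have /implyP/(_ sI) nI := nb (core :&: G)%SET.
have /implyP/(_ sD) nD := nb (core :\: G)%SET.
have cID : (#|core :&: G| + #|core :\: G| = #|core|)%N := cardsID G core.
case: (ltnP (2 * #|T|)%N (3 * #|core :&: G|)%N) => [/(Kmin _ sI) KI|I2].
  have /eqP <- : (core :&: G == core)%SET by rewrite eqEcard subsetIl.
  exact: subsetIr.
have I0 : (0 < #|core :&: G|)%N by apply/card_gt0P; exists x; rewrite inE xK.
have := Kmin _ sD; lia.
Qed.

End CutSets.

Section NullTriangles.
Variables (n : nat) (T : {set {set 'I_n}}) (Q : 'I_n -> 'I_n -> 'I_n -> Prop).
Implicit Types a b c x y : 'I_n.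

Definition common_link (S : {set {set 'I_n}}) a b : rel 'I_n :=
  fun x y => ([set a; x; y]%SET \in S) && ([set b; x; y]%SET \in S).

Definition off_edge a b : {set {set 'I_n}} :=
  [set F in triples n | ~~ ([set a; b]%SET \subset F)].

(* The graph only sees the faces that do not contain both [a] and [b], which makes
   its core independent of the faces [abx]. *)
Definition good_pair a b :=
  no_balanced_cut (common_link (T :&: off_edge a b)%SET a b) &&
  [exists x in core (common_link (T :&: off_edge a b)%SET a b), [set a; b; x]%SET \in T].

Hypothesis good : forall a b, a != b -> good_pair a b.
Hypothesis Q_face : forall a b c, [set a; b; c]%SET \in faces2 T -> Q a b c.
Hypothesis Q_swap23 : forall a b c, Q a b c -> Q a c b.
Hypothesis Q_cone : forall a b c x, Q a b x -> Q b c x -> Q a c x -> Q a b c.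

Lemma Q_degenerate a b c : (a == b) || (b == c) || (a == c) -> Q a b c.
Proof.
move=> abc; apply: Q_face; rewrite inE inE; apply/orP; left.
case/orP: abc => [/orP[]|] /eqP->.
- by rewrite finset.setUid cards2; case: eqP.
- by rewrite -finset.setUA finset.setUid cards2; case: eqP.
- by rewrite finset.setUC finset.setUA finset.setUid cards2; case: eqP.
Qed.

Lemma Q_triple a b c : [set a; b; c]%SET \in T -> Q a b c.
Proof.
move=> abcT; apply: Q_face; rewrite !inE abcT /=.
rewrite orbC -ltnS -leq_eqVlt.
have := leq_card_setU [set a; b]%SET [set c]%SET.
by rewrite cards1 cards2 => /leq_of_leqif/leq_trans; apply; case: eqP.
Qed.

Lemma card_Q a b : a != b -> (2 * n < 3 * #|[set c | `[< Q a b c >]]%SET|)%N.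
Proof.
move=> ab; have /andP[nb /existsP[x /andP[xK abxT]]] := good ab.
have n0 : (0 < #|{: 'I_n}|)%N by apply/card_gt0P; exists a.
have [_ K2 _] := core_spec (common_link (T :&: off_edge a b)%SET a b) n0.
rewrite card_ord in K2; apply: leq_trans K2 _; rewrite leq_mul2l /=.
apply: subset_leq_card; apply: (core_sub nb _ xK).
  (* An edge u v of the link makes auv and buv faces, so the triangle abv is coned over u, and abu
     over v. *)
  have step u v : common_link (T :&: off_edge a b)%SET a b u v -> Q a b u <-> Q a b v.
    move=> /andP[]; rewrite !inE => /andP[/Q_triple auv _] /andP[/Q_triple buv _].
    by split => q; apply: Q_cone q _ _ => //; exact: Q_swap23.
  by apply/separatedP => u v /step uv; rewrite !inE; apply/asboolP/asboolP => /uv.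
by rewrite inE; apply/asboolP; exact: Q_triple.
Qed.

Lemma Q_all a b c : Q a b c.
Proof.
have [|] := boolP ((a == b) || (b == c) || (a == c)); first exact: Q_degenerate.
rewrite !negb_or => /andP[/andP[ab bc] ac].
have [v] := meet_three_large (card_Q ab) (card_Q bc) (card_Q ac).
rewrite !inE => /and3P[/asboolP abv /asboolP bcv /asboolP acv].
exact: Q_cone abv bcv acv.
Qed.

End NullTriangles.

(** * Random subsets *)

Section RandomSubset.
Variables (R : realType) (I : finType) (p : R).
Hypothesis p01 : 0 <= p <= 1.
Implicit Types (A B D T S : {set I}) (f g h : {set I} -> R).

(** The law of the binomial random subset of [D]; all probabilities below are finite sums against
    it. *)
Definition weight D T : R := \prod_(i in D) (if i \in T then p else 1 - p).

Definition expect D h : R := \sum_(T in powerset D) weight D T * h T.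

Definition prob D (E : pred {set I}) : R := expect D (fun T => (E T)%:R).

Lemma weight_ge0 D T : 0 <= weight D T.
Proof.
by have /andP[p0 p1] := p01; apply: prodr_ge0 => i _; case: ifP => _ //; lra.
Qed.

Lemma expect_le D f g : (forall T, T \subset D -> f T <= g T) ->
  expect D f <= expect D g.
Proof.
move=> fg; apply: ler_sum => T; rewrite powersetE => TD.
by rewrite ler_wpM2l ?weight_ge0 // fg.
Qed.

Lemma eq_expect D f g : (forall T, T \subset D -> f T = g T) ->
  expect D f = expect D g.
Proof. by move=> fg; apply: eq_bigr => T; rewrite powersetE => TD; rewrite fg. Qed.

Lemma expect_sum D (J : finType) (P : pred J) (h : J -> {set I} -> R) :
  expect D (fun T => \sum_(j | P j) h j T) = \sum_(j | P j) expect D (h j).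
Proof. by rewrite exchange_big; apply: eq_bigr => T _; rewrite mulr_sumr. Qed.

Lemma expectD D f g : expect D (fun T => f T + g T) = expect D f + expect D g.
Proof. by rewrite -big_split; apply: eq_bigr => T _; rewrite mulrDr. Qed.

Lemma expectMl D (k : R) f : expect D (fun T => k * f T) = k * expect D f.
Proof. by rewrite mulr_sumr; apply: eq_bigr => T _; rewrite mulrCA. Qed.

Lemma expect1 D : expect D (fun=> 1) = 1.
Proof.
(* Expanding this product over all points gives one term per subset; the factor 0 outside [D] kills
   the subsets not contained in [D]. *)
transitivity (\prod_i ((if i \in D then p else 0) + (if i \in D then 1 - p else 1))).
  rewrite bigA_distr /expect [RHS](bigID (fun T => T \in powerset D)) /=.
  rewrite [X in _ + X]big1 ?addr0 => [|T]; last first.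
    rewrite powersetE => /fintype.subsetPn[i iT iD].
    by rewrite (bigD1 i) //= iT (negbTE iD) mul0r.
  apply: eq_bigr => T; rewrite mulr1 powersetE => /fintype.subsetP TD.
  rewrite /weight big_mkcond; apply: eq_bigr => i _.
  by case: ifP => // /negbT iD; rewrite (contraNF (TD i) iD).
by apply: big1 => i _; case: ifP => _; rewrite ?add0r // addrC subrK.
Qed.

Lemma expect_cst D (k : R) : expect D (fun=> k) = k.
Proof.
transitivity (expect D (fun=> k * 1)); first by rewrite mulr1.
by rewrite expectMl expect1 mulr1.
Qed.

(** Independence in Fubini form: the traces of the random set on [A] and on [B] determine it and
    their weights multiply. *)
Lemma expectU A B h : [disjoint A & B]%B ->
  expect (A :|: B)%SET h = expect A (fun S => expect B (fun T => h (S :|: T)%SET)).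
Proof.
move=> AB; rewrite /expect.
under [RHS]eq_bigr do rewrite mulr_sumr.
rewrite pair_big /=.
rewrite (reindex_onto (fun q : {set I} * {set I} => (q.1 :|: q.2)%SET)
   (fun T => ((T :&: A)%SET, (T :&: B)%SET))) /=; last first.
  by move=> T; rewrite powersetE -finset.setIUr => /finset.setIidPl.
have dis S T : S \subset A -> T \subset B ->
    [/\ (S :&: A = S)%SET, (T :&: A = finset.set0)%SET,
        (S :&: B = finset.set0)%SET & (T :&: B = T)%SET].
  move=> SA TB; split; first exact/finset.setIidPl.
  - by apply/eqP; rewrite setI_eq0 disjoint_sym (disjointWr TB).
  - by apply/eqP; rewrite setI_eq0 (disjointWl SA).
  - exact/finset.setIidPl.
apply: eq_big => [[S T]|[S T]] /=.
  rewrite !powersetE; apply/andP/andP => [[ST /eqP[<- <-]]|[SA TB]].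
    by rewrite !finset.subsetIr.
  split; first exact: finset.setUSS.
  by have [e1 e2 e3 e4] := dis _ _ SA TB; rewrite !finset.setIUl e1 e2 e3 e4
    finset.setU0 finset.set0U.
move=> /andP[_ /eqP[eS eT]].
have SA : S \subset A by rewrite -eS finset.subsetIr.
have TB : T \subset B by rewrite -eT finset.subsetIr.
rewrite mulrA; congr (_ * _); rewrite /weight.
rewrite (eq_bigl [in [predU A & B]]) => [|i]; last by rewrite !inE.
rewrite bigU //=; congr (_ * _); apply: eq_bigr => i iD.
  rewrite inE; suff -> : i \in T = false by rewrite orbF.
  by apply/negP => /(fintype.subsetP TB); rewrite (disjointFr AB iD).
rewrite inE; suff -> : i \in S = false by [].
by apply/negP => /(fintype.subsetP SA); rewrite (disjointFl AB iD).
Qed.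

Lemma prob_contains B : prob B (fun T => B \subset T) = p ^+ #|B|.
Proof.
rewrite /prob /expect (bigD1 B) ?powersetE //= big1 => [|T /andP[]]; last first.
  rewrite powersetE finset.eqEsubset => -> /= /negbTE->; exact: mulr0.
rewrite subxx mulr1 addr0 /weight (eq_bigr (fun=> p)) => [|i ->//].
by rewrite prodr_const.
Qed.

(** Events carried by disjoint blocks are independent. The induction splits one block off the ground
    set, which is why [D] varies. *)
Lemma prob_avoid (J : eqType) (r : seq J) (B : J -> {set I}) D :
  pairwise (fun i j => [disjoint B i & B j]%B) r -> {in r, forall j, B j \subset D} ->
  prob D (fun T => all (fun j => ~~ (B j \subset T)) r) = \prod_(j <- r) (1 - p ^+ #|B j|).
Proof.
elim: r D => [|j r IH] D /=; first by move=> _ _; rewrite big_nil; exact: expect1.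
move=> /andP[/allP jr rr] rD; rewrite big_cons.
have jD : B j \subset D by apply: rD; rewrite inE eqxx.
have dis : [disjoint B j & (D :\: B j)%SET]%B 
  by rewrite finset.disjoints_subset; apply/fintype.subsetP => i iB; rewrite !inE iB.
have DE : D = (B j :|: (D :\: B j))%SET.
  by rewrite -{1}(finset.setID D (B j)); congr (_ :|: _)%SET; exact/finset.setIidPr.
rewrite {1}DE /prob expectU //.
have IHr : prob (D :\: B j)%SET (fun T => all (fun j => ~~ (B j \subset T)) r) =
    \prod_(i <- r) (1 - p ^+ #|B i|).
  apply: IH => // i ir; rewrite finset.subsetD rD ?inE ?ir ?orbT //.
  by rewrite disjoint_sym jr.
have subU A S T : [disjoint A & T]%B -> (A \subset S :|: T)%SET = (A \subset S).
  move=> AT; apply/idP/idP => [AST|AS]; last exact: fintype.subset_trans AS (finset.subsetUl _ _).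
  apply/fintype.subsetP => i iA; have /setUP[//|iT] := fintype.subsetP AST i iA.
  by rewrite (disjointFr AT iA) in iT.
(* The condition on [B j] sees only the trace [S], the remaining conditions only the trace [T]. *)
transitivity (expect (B j) (fun S => (~~ (B j \subset S))%:R * \prod_(i <- r) (1 - p ^+ #|B i|))).
  apply: eq_expect => S SB; rewrite -IHr -expectMl; apply: eq_expect => T TD.
  rewrite -natrM mulnb subU; last by rewrite (disjointWr TD).
  congr ((_ && _)%:R); apply: eq_in_all => i ir.
  rewrite finset.setUC subU //; apply: disjointWr SB _.
  by rewrite disjoint_sym jr.
under eq_expect do rewrite mulrC.
rewrite expectMl mulrC; congr (_ * _); rewrite -prob_contains.
apply/esym/eqP; rewrite subr_eq eq_sym; apply/eqP.
rewrite -expectD -[RHS](expect1 (B j)); apply: eq_expect => T _.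
by case: (B j \subset T); rewrite ?addr0 ?add0r.
Qed.

End RandomSubset.

(** * Probability that a pair of vertices is not good *)

Section PairBounds.
Variables (R : realType) (n : nat) (p : R).
Hypothesis p01 : 0 <= p <= 1.
Implicit Types (T S : {set {set 'I_n}}) (W K : {set 'I_n}) (x y : 'I_n).

(** The union bound, at the level of indicators. *)
Lemma indicator_exists_le (J : finType) (P E : pred J) :
  [exists j, P j && E j]%:R <= \sum_(j | P j) (E j)%:R :> R.
Proof.
have [/existsP[j /andP[Pj Ej]]|_] := boolP [exists j, P j && E j].
  by rewrite (bigD1 j) //= Ej lerDl; apply: sumr_ge0 => i _; rewrite ler0n.
by rewrite mulr0n; apply: sumr_ge0 => i _; rewrite ler0n.
Qed.

Lemma card_triple x y z : x != y -> x != z -> y != z -> #|[set x; y; z]%SET| = 3%N.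
Proof.
move=> xy xz yz; rewrite finset.setUC cardsU1 !inE negb_or cards2.
by rewrite (eq_sym z) xz (eq_sym z) yz xy.
Qed.

Variables (a b : 'I_n).
Hypothesis ab : a != b.

Local Notation A := (off_edge a b).
Local Notation ends := [set a; b]%SET.

(** If [W] is separated, then for each x in [W] and y outside, both off the ends, axy and bxy are
    not both faces. Each such event has probability 1 - p^2, and different pairs involve disjoint
    sets of triples. *)
Lemma prob_separated W :
  prob p (triples n) (fun T => separated (common_link (T :&: A)%SET a b) W) <=
  (1 - p ^+ 2) ^+ (#|(W :\: ends)%SET| * #|(~: W :\: ends)%SET|).
Proof.
set U := (W :\: ends)%SET; set U' := (~: W :\: ends)%SET.
pose B (q : 'I_n * 'I_n) := [set [set a; q.1; q.2]; [set b; q.1; q.2]]%SET.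
pose r := enum (finset.setX U U').
have rP q : q \in r -> [/\ q.1 \in W, q.2 \notin W, q.1 \notin ends & q.2 \notin ends].
  by rewrite mem_enum !inE => /andP[/andP[-> ->] /andP[-> ->]].
have cU q e : q \in r -> e \in ends -> #|[set e; q.1; q.2]%SET| = 3%N.
  move=> /rP[q1 q2 e1 e2] ee; apply: card_triple.
  - by apply: contraNneq e1 => <-.
  - by apply: contraNneq e2 => <-.
  - by apply: contraNneq q2 => <-.
have aE : a \in ends by rewrite !inE eqxx.
have bE : b \in ends by rewrite !inE eqxx orbT.
have BP q F : F \in B q -> exists2 e, e \in ends & F = [set e; q.1; q.2]%SET.
  by rewrite !inE => /orP[]/eqP->; [exists a|exists b].
have in_triple (q' : 'I_n * 'I_n) e' x : e' \in ends -> x \notin ends ->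
    x \in [set e'; q'.1; q'.2]%SET -> (x == q'.1) || (x == q'.2).
  move=> e'E xE; rewrite !inE => /orP[/orP[/eqP xe|->//]|->]; last by rewrite orbT.
  by rewrite xe e'E in xE.
(* A shared triple forces the same two points off the ends; membership in [W] tells which comes
   first, so the ordered pairs agree. *)
have dis q q' : q \in r -> q' \in r -> q != q' -> [disjoint B q & B q']%B.
  move=> qr q'r; apply: contraR => /pred0Pn[F /andP[/= /BP[e eE ->]]].
  move=> /BP[e' e'E FE].
  have [q1 q2 e1 e2] := rP _ qr; have [q'1 q'2 e'1 e'2] := rP _ q'r.
  have h1 : q.1 \in [set e'; q'.1; q'.2]%SET by rewrite -FE !inE eqxx ?orbT.
  have h2 : q.2 \in [set e'; q'.1; q'.2]%SET by rewrite -FE !inE eqxx ?orbT.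
  have /orP[/eqP E1|/eqP E1] := in_triple _ _ _ e'E e1 h1; last by rewrite E1 (negbTE q'2) in q1.
  have /orP[/eqP E2|/eqP E2] := in_triple _ _ _ e'E e2 h2; first by rewrite E2 q'1 in q2.
  by rewrite [q]surjective_pairing [q']surjective_pairing E1 E2.
have Btri : {in r, forall q, B q \subset triples n}.
  move=> q qr; apply/fintype.subsetP => F /BP[e eE ->].
  by rewrite inE (cU _ _ qr eE).
have Bcard : {in r, forall q, #|B q| = 2}.
  move=> q qr; rewrite cards2 (_ : _ != _) //; apply/eqP => E.
  have [_ _ e1 e2] := rP _ qr.
  have : a \in [set b; q.1; q.2]%SET by rewrite -E !inE eqxx.
  rewrite !inE (negbTE ab) /= => /orP[]/eqP aq; first by rewrite -aq aE in e1.
  by rewrite -aq aE in e2.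
have rdis : pairwise (fun q q' => [disjoint B q & B q']%B) r.
  have := enum_uniq (finset.setX U U'); rewrite uniq_pairwise -/r.
  by apply: sub_in_pairwise (allss r) => q q' /=; exact: dis.
have -> : (1 - p ^+ 2) ^+ (#|U| * #|U'|) = \prod_(q <- r) (1 - p ^+ #|B q|).
  rewrite big_enum (eq_bigr (fun=> 1 - p ^+ 2)) => [|q qU].
    by rewrite prodr_const cardsX.
  by rewrite Bcard // mem_enum.
rewrite -(prob_avoid p rdis Btri); apply: expect_le => // T _; rewrite ler_nat.
case: separatedP => //= sW; rewrite lt0n eqb0 negbK; apply/allP => q qr.
have [q1 q2 e1 e2] := rP _ qr.
apply/negP => /fintype.subsetP BT; suff /sW : common_link (T :&: A)%SET a b q.1 q.2.
  by rewrite q1 (negbTE q2).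
(* Such a triple misses the other end, so it survives the restriction to [off_edge a b]. *)
have offA e : e \in ends -> [set e; q.1; q.2]%SET \in A.
  move=> eE; rewrite inE inE (cU _ _ qr eE) eqxx /=.
  have [f fE fe] : exists2 f, f \in ends & f != e.
    move: eE; rewrite !inE => /orP[]/eqP->; [exists b|exists a] => //.
    by rewrite eq_sym.
  apply/negP => /fintype.subsetP/(_ f fE); rewrite !inE (negbTE fe) /=.
  by case/orP => /eqP fq; [rewrite -fq fE in e1|rewrite -fq fE in e2].
by apply/andP; split; rewrite finset.in_setI offA // BT // !inE eqxx ?orbT.
Qed.

(** The faces in [off_edge a b] are fixed first, and with them the core. The triples abx lie in the
    complementary part [C], so they are still independent of what has been fixed. *)
Lemma prob_core_missed : (12 <= n)%N ->
  prob p (triples n) (fun T =>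
    ~~ [exists x in core (common_link (T :&: A)%SET a b), [set a; b; x]%SET \in T]) <=
  (1 - p) ^+ n./2.
Proof.
move=> n12; have /andP[p0 p1] := p01.
pose C := (triples n :\: A)%SET.
have AD : A \subset triples n by apply/fintype.subsetP => F; rewrite inE => /andP[].
have DE : triples n = (A :|: C)%SET.
  by rewrite -{1}(finset.setID (triples n) A); congr (_ :|: _)%SET; exact/finset.setIidPr.
have AC : [disjoint A & C]%B.
  by rewrite finset.disjoints_subset; apply/fintype.subsetP => F FA; rewrite finset.in_setC finset.in_setD FA.
rewrite /prob DE expectU // -(expect_cst p A ((1 - p) ^+ n./2)).
apply: expect_le => // S SA.
pose K := core (common_link S a b); pose r := enum (K :\: ends)%SET.
pose B x := [set [set a; b; x]]%SET.
have rP x : x \in r -> x \in K /\ x \notin ends.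
  by rewrite mem_enum finset.in_setD => /andP[].
have BC : {in r, forall x, B x \subset C}.
  move=> x /rP[_ xE]; rewrite finset.sub1set finset.in_setD.
  have xa : a != x by apply: contraNneq xE => <-; rewrite !inE eqxx.
  have xb : b != x by apply: contraNneq xE => <-; rewrite !inE eqxx orbT.
  by rewrite [_ \in A]inE finset.subsetUl andbF /= inE card_triple.
have rdis : pairwise (fun x y => [disjoint B x & B y]%B) r.
  have := enum_uniq (K :\: ends)%SET; rewrite uniq_pairwise -/r.
  apply: sub_in_pairwise (allss r) => x y /rP[_ xE] _ /= xy.
  rewrite disjoints1 inE; apply: contraNneq xy => /setP/(_ x); move: xE.
  by rewrite !inE negb_or eqxx => /andP[/negbTE-> /negbTE->] /= <-.
apply: (@le_trans _ _ (prob p C (fun T => all (fun x => ~~ (B x \subset T)) r))).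
  apply: expect_le => // T TC; rewrite ler_nat.
  have -> : ((S :|: T) :&: A = S)%SET.
    rewrite finset.setIUl (finset.setIidPl SA); apply/finset.setUidPl.
    by rewrite (_ : T :&: A = finset.set0)%SET ?finset.sub0set //; apply/eqP;
      rewrite setI_eq0 disjoint_sym (disjointWr TC).
  case: existsP => //= nex; rewrite lt0n eqb0 negbK; apply/allP => x /rP[xK xE].
  rewrite finset.sub1set; apply/negP => xT; apply: nex; exists x.
  by rewrite xK finset.in_setU xT orbT.
rewrite (prob_avoid p rdis BC) big_enum (eq_bigr (fun=> 1 - p)) => [|x _]; last first.
  by rewrite cards1 expr1.
rewrite prodr_const; apply: ler_wiXn2l; [by lra|by lra|].
(* The core has more than 2n/3 points; dropping the two ends leaves at least n/2 rounded down. *)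
have n0 : (0 < #|{: 'I_n}|)%N by rewrite card_ord; lia.
have [_ + _] := core_spec (common_link S a b) n0; rewrite card_ord -/K.
have := cardsID ends K; have := subset_leq_card (finset.subsetIr K ends).
rewrite cards2; case: (a != b) => /=; lia.
Qed.

Definition balanced W := ((n <= 3 * #|W|) && (3 * #|W| <= 2 * n))%N.

Lemma prob_bad_pair : (12 <= n)%N ->
  prob p (triples n) (fun T => ~~ good_pair T a b) <=
  \sum_(W | balanced W)
     (1 - p ^+ 2) ^+ (#|(W :\: ends)%SET| * #|(~: W :\: ends)%SET|) + (1 - p) ^+ n./2.
Proof.
move=> n12; apply: (@le_trans _ _ (expect p (triples n) (fun T =>
    \sum_(W | balanced W) (separated (common_link (T :&: A)%SET a b) W)%:R +
    (~~ [exists x in core (common_link (T :&: A)%SET a b), [set a; b; x]%SET \in T])%:R))).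
  apply: expect_le => // T _; rewrite /good_pair negb_and.
  set E := [exists x in _, _].
  apply: (@le_trans _ _ ((~~ no_balanced_cut (common_link (T :&: A)%SET a b))%:R + (~~ E)%:R)).
    by rewrite -natrD ler_nat; do 2 case: (~~ _).
  rewrite lerD2r; apply: le_trans (indicator_exists_le _ _).
  rewrite ler_nat /no_balanced_cut negb_forall.
  case: existsP => // -[W]; rewrite negb_imply negbK card_ord => /andP[sW bW].
  by rewrite lt0b; apply/existsP; exists W; rewrite sW andbT.
rewrite expectD expect_sum lerD ?prob_core_missed //.
by apply: ler_sum => W _; exact: prob_separated.
Qed.

End PairBounds.

(** * Union bound over pairs and estimates at the threshold *)

Section Threshold.
Variable R : realType.

Lemma good_pairs_pi1_trivial (n : nat) (T : {set {set 'I_n}}) :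
  (forall a b, a != b -> good_pair T a b) -> complex_pi1_trivial R (complex2 T).
Proof.
move=> good.
have edges i j : [set i; j]%SET \in faces (complex2 T).
  by rewrite /= !inE cards2; case: (i != j).
apply: complex_pi1_trivial_flat => //; apply: (Q_all good).
- by move=> a b c; exact: (@flat_face R n (complex2 T)).
- by move=> a b c; exact: (flat_swap23 edges).
- by move=> a b c x; exact: (flat_cone edges).
Qed.

Lemma Pr_X2_lower (n : nat) (p : R) : 0 <= p <= 1 ->
  1 - \sum_(q : 'I_n * 'I_n | q.1 != q.2)
        prob p (triples n) (fun T => ~~ good_pair T q.1 q.2) <=
  Pr_X2 p [set X : simplicial_complex n | complex_pi1_trivial R X].
Proof.
move=> p01; set E := mkset _.
have -> : Pr_X2 p E = prob p (triples n) (fun T => `[<E (complex2 T)>]).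
  rewrite /Pr_X2 big_mkcondr; apply: eq_bigr => T _.
  by case: ifP => _; rewrite ?mulr1 ?mulr0.
rewrite lerBlDr /prob -expect_sum -expectD -[leLHS](expect1 p (triples n)).
apply: expect_le => // T _; case: asboolP => [_|nE].
  by rewrite mulr1n lerDl; apply: sumr_ge0 => q _; rewrite ler0n.
rewrite mulr0n add0r; apply: le_trans (indicator_exists_le _ _ _).
rewrite (ler_nat _ 1) lt0b; apply: contrapT => /negP/existsPn good; apply: nE.
apply: good_pairs_pi1_trivial => a b ab.
by have := good (a, b); rewrite /= ab negbK.
Qed.

Lemma Pr_X2_le1 (n : nat) (p : R) (E : set (simplicial_complex n)) : 0 <= p <= 1 ->
  Pr_X2 p E <= 1.
Proof.
move=> p01; rewrite -[leRHS](expect1 p (triples n)) /Pr_X2 big_mkcondr; apply: ler_sum => T _.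
by rewrite mulr1; case: ifP => _ //; exact: weight_ge0.
Qed.

Lemma exprn_le_expR (x : R) (k : nat) : x <= 1 -> (1 - x) ^+ k <= expR (- (x * k%:R)).
Proof.
move=> x1; rewrite -mulNr expRM_natr.
by apply: lerXn2r; rewrite ?nnegrE ?expR_ge0 ?expR_ge1Dx ?subr_ge0.
Qed.

(** Inverts the bound of [expR x] from below by one term of its series; this turns exponential
    bounds into polynomial ones. *)
Lemma expRN_le (x : R) (k : nat) : 0 < x -> expR (- x) <= k.+1`!%:R / x ^+ k.+1.
Proof.
move=> x0; rewrite expRN -[leRHS]invrK invf_div lef_pV2 ?posrE ?expR_gt0 //.
  by apply: le_trans (expR_ge1Dxn k (ltW x0)); rewrite lerDr.
by rewrite divr_gt0 ?exprn_gt0 // ltr0n fact_gt0.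
Qed.

(** Each side has at least n/3 points, hence at least n/3 - 2 off the ends, and this is at least n/4
    once n >= 24. *)
Lemma balanced_cut_size (n : nat) (a b : 'I_n) (W : {set 'I_n}) :
  (24 <= n)%N -> balanced W ->
  (n * n <= 16 * (#|(W :\: [set a; b])%SET| * #|(~: W :\: [set a; b])%SET|))%N.
Proof.
move=> n24 /andP[W1 W2].
have ends (U : {set 'I_n}) : (#|U| <= #|(U :\: [set a; b])%SET| + 2)%N.
  rewrite -(cardsID [set a; b]%SET U) addnC leq_add2l.
  apply: leq_trans (subset_leq_card (finset.subsetIr _ _)) _.
  by rewrite cards2; case: (a != b).
have key (w w' u u' : nat) : (w + w' = n -> n <= 3 * w -> 3 * w <= 2 * n ->
    w <= u + 2 -> w' <= u' + 2 -> n * n <= 16 * (u * u'))%N.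
  move=> *; rewrite (_ : 16 * (u * u') = (4 * u) * (4 * u'))%N; last by lia.
  by apply: leq_mul; lia.
by apply: key W1 W2 (ends _) (ends _); rewrite cardsC card_ord.
Qed.

Lemma prob_bad_pair_le (n : nat) (p : R) (a b : 'I_n) : (24 <= n)%N ->
  0 <= p <= 1 -> 32 / n%:R <= p ^+ 2 -> a != b ->
  prob p (triples n) (fun T => ~~ good_pair T a b) <= 33 / n%:R ^+ 3.
Proof.
move=> n24 p01 pn ab; have /andP[p0 p1] := p01.
have n0 : 0 < n%:R :> R by rewrite ltr0n; lia.
have p21 : p ^+ 2 <= 1 by rewrite expr_le1.
apply: le_trans (prob_bad_pair p01 ab _) _; first by lia.
(* The exponent is at least (32/n)(n^2/16) = 2n, and there are at most 2^n cuts, with 2 <= e. *)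
have cuts : \sum_(W : {set 'I_n} | balanced W)
    (1 - p ^+ 2) ^+ (#|(W :\: [set a; b])%SET| * #|(~: W :\: [set a; b])%SET|) <=
    expR (- n%:R).
  apply: (@le_trans _ _ (\sum_(W : {set 'I_n}) expR (- (2 * n%:R)))).
    rewrite big_mkcond; apply: ler_sum => W _; case: ifP => [bW|_]; last exact: expR_ge0.
    apply: le_trans (exprn_le_expR _ p21) _; rewrite ler_expR lerN2.
    have := balanced_cut_size a b n24 bW; move: (#|_| * #|_|)%N => k.
    rewrite -(ler_nat R) !natrM => nk.
    apply: (@le_trans _ _ (32 / n%:R * k%:R)); last by rewrite ler_wpM2r.
    rewrite mulrAC ler_pdivlMr //; nra.
  have card_sets : #|{: {set 'I_n}}| = (2 ^ n)%N.
    have -> : (2 ^ n = #|powerset [set: 'I_n]%SET|)%N.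
      by rewrite card_powerset cardsT card_ord.
    by apply: eq_card => W; rewrite powersetE finset.subsetT.
  rewrite sumr_const card_sets -(mulr_natr (expR _)) natrX.
  rewrite (_ : - (2 * n%:R) = - n%:R + - n%:R); last by lra.
  rewrite expRD -mulrA ler_piMr ?expR_ge0 //.
  rewrite expRN mulrC ler_pdivrMr ?expR_gt0 // mul1r -[n%:R]mul1r expRM_natr.
  apply: lerXn2r; rewrite ?nnegrE ?expR_ge0 //.
  by apply: le_trans (expR_ge1Dx 1).
(* Here 6 is 3! from the cubic bound on exp(-n); 27 bounds 6!/27, from the bound of order six on the
   missed core. *)
apply: (@le_trans _ _ (6 / n%:R ^+ 3 + 27 / n%:R ^+ 3)); last by rewrite -mulrDl; lra.
apply: lerD; first exact: le_trans cuts (expRN_le 2 n0).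
apply: le_trans (exprn_le_expR _ p1) _.
(* The loss from n/2 to n/3 absorbs the rounding of [n./2]; the square below is then at least 32n/9,
   which exceeds 3n. *)
have h2 : n%:R / 3 <= n./2%:R :> R.
  rewrite ler_pdivrMr // -natrM ler_nat; lia.
have pp : 0 < p ^+ 2 by apply: lt_le_trans pn; rewrite divr_gt0.
have p_gt0 : 0 < p by rewrite lt0r p0 andbT; apply: contraTneq pp => ->; rewrite expr0n ltxx.
have x0 : 0 < p * n./2%:R by rewrite mulr_gt0 // ltr0n; lia.
apply: le_trans (expRN_le 5 x0) _.
have x2 : 3 * n%:R <= (p * n./2%:R) ^+ 2.
  rewrite exprMn; apply: (@le_trans _ _ (32 / n%:R * (n%:R / 3) ^+ 2)).
    have -> : 32 / n%:R * (n%:R / 3) ^+ 2 = 32 / 9 * n%:R :> R.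
      by field; rewrite gt_eqF.
    by lra.
  apply: ler_pM; rewrite ?exprn_ge0 ?divr_ge0 ?ler0n //.
  by apply: lerXn2r; rewrite ?nnegrE ?divr_ge0 ?ler0n.
have x6 : 27 * n%:R ^+ 3 <= (p * n./2%:R) ^+ 6.
  rewrite (_ : 27 * _ = (3 * n%:R) ^+ 3); last by rewrite exprMn; lra.
  by rewrite (exprM _ 2 3) lerXn2r // nnegrE ?mulr_ge0 ?exprn_ge0 // ltW.
rewrite ler_pdivrMr ?exprn_gt0 //.
rewrite mulrAC ler_pdivlMr ?exprn_gt0 //.
rewrite (_ : 6`!%:R = 720 :> R); last by [].
nra.
Qed.

End Threshold.

Lemma Pr_X2_pi1_trivial_lower (R : realType) (n : nat) (p : R) : (24 <= n)%N ->
  0 <= p <= 1 -> 32 / n%:R <= p ^+ 2 ->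
  1 - 33 / n%:R <= Pr_X2 p [set X : simplicial_complex n | complex_pi1_trivial R X].
Proof.
move=> n24 p01 pn; apply: le_trans _ (Pr_X2_lower n p01); rewrite lerD2l lerN2.
have n0 : 0 < n%:R :> R by rewrite ltr0n; lia.
(* There are at most n^2 ordered pairs, each bad with probability at most 33/n^3. *)
apply: (@le_trans _ _ (\sum_(q : 'I_n * 'I_n) 33 / n%:R ^+ 3)).
  rewrite big_mkcond; apply: ler_sum => q _; case: ifP => [qq|_].
    exact: prob_bad_pair_le.
  by rewrite divr_ge0 ?exprn_ge0.
rewrite sumr_const card_prod card_ord -(mulr_natr (33 / _)) natrM.
rewrite (_ : _ * _ = 33 / n%:R) //; field; by rewrite gt_eqF.
Qed.

Theorem theorem3 (R : realType) :
  exists c : R, 0 < c /\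
    forall p : nat -> R,
      (forall n, 0 <= p n <= 1) ->
      (\forall n \near \oo, Num.sqrt (c / n%:R) <= p n) ->
      (fun n => Pr_X2 (p n) [set X : simplicial_complex n |
                              complex_pi1_trivial R X]) @ \oo --> (1 : R).
Proof.
(* The value 32 makes p^2 times the n^2/16 pairs across a balanced cut at least 2n, enough to beat
   the 2^n cuts. *)
exists 32; split => // p p01 ple.
(* Since [harmonic n] is 1/(n+1), the bound 33/n is replaced by 66/(n+1), valid for n >= 1. *)
apply: (@squeeze_cvgr _ _ _ _ (fun n => 1 - 66 * harmonic n) (cst 1)).
- near=> n; rewrite Pr_X2_le1 // andbT.
  have n24 : (24 <= n)%N by near: n; exact: nbhs_infty_ge.
  have n0 : 0 < n%:R :> R by rewrite ltr0n; lia.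
  have p32 : 32 / n%:R <= p n ^+ 2.
    rewrite -[leLHS]sqr_sqrtr ?divr_ge0 ?(ltW n0) //.
    have /andP[pn0 _] := p01 n; rewrite lerXn2r ?nnegrE ?sqrtr_ge0 //.
    by near: n.
  apply: le_trans _ (Pr_X2_pi1_trivial_lower n24 (p01 n) p32).
  rewrite lerD2l lerN2 /harmonic ler_pdivrMr // mulrAC ler_pdivlMr //.
  by rewrite -natr1; have : 1 <= n%:R :> R; [rewrite ler1n; lia|lra].
- rewrite -[X in _ --> X]subr0 -[X in _ - X](mulr0 66).
  by apply: cvgB; [exact: cvg_cst|apply: cvgMr; exact: cvg_harmonic].
- exact: cvg_cst.
Unshelve. all: by end_near.
Qed.
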